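(* Let $\mathbb{H}$ be a complex Hilbert space and let $T\in B(\mathbb{H})$. Then $$w^2(T)\le w(T^2)+\min\left\{\|\mathrm{Re}(T)\|^2,\ \|\mathrm{Im}(T)\|^2\right\}.$$
   Context: $B(\mathbb{H})$ is the set of bounded linear operators on $\mathbb{H}$, and $\|\cdot\|$ is the operator norm. The numerical radius of $T\in B(\mathbb{H})$ is $w(T)=\sup\{|\langle Tx,x\rangle| : x\in\mathbb{H},\ \|x\|=1\}$, and $w^2(T)$ means $(w(T))^2$. $\mathrm{Re}(T)=\frac12(T+T^* )$ and $\mathrm{Im}(T)=\frac{1}{2i}(T-T^* )$. *)

(* Defs.v *)
From HB Require Import structures.
From mathcomp Require Import all_boot all_order all_algebra.
From mathcomp Require Import all_classical all_reals all_analysis.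
From mathcomp Require Import sesquilinear complex.

Set Implicit Arguments.
Unset Strict Implicit.
Unset Printing Implicit Defensive.

Import Order.TTheory GRing.Theory Num.Theory.
Import numFieldNormedType.Exports.

Local Open Scope classical_set_scope.
Local Open Scope ring_scope.

(* The inner product is linear in its first argument and conjugate-linear in
   the second. *)
HB.mixin Record isHilbert (R : realType) H of CompleteNormedModule R[i] H := {
  inner : {dot H for Num.conj};
  sqr_norm_inner : forall x : H, `|x| ^+ 2 = inner x x
}.

#[short(type="hilbertType")]
HB.structure Definition Hilbert (R : realType) :=
  {H of CompleteNormedModule R[i] H & isHilbert R H}.

(* Norms in a normed space over R[i] take values in R[i]; their imaginary part
   is 0, and this is the corresponding element of R. *)
Definition rnorm (R : realType) (V : normedZmodType R[i]) (x : V) : R :=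
  complex.Re `|x|.

Section Operators.
Context {R : realType} {H : hilbertType R}.
Implicit Types T S : {linear H -> H}.

Definition bounded_op T := exists M : R, forall x : H, rnorm (T x) <= M * rnorm x.

Definition opnorm T : R :=
  sup [set rnorm (T x) | x in [set x : H | rnorm x <= 1]].

(* Since sup set0 = 0, this is 0 when H is the zero space. *)
Definition numrad T : R :=
  sup [set rnorm (inner (T x) x) | x in [set x : H | rnorm x = 1]].

Definition is_adjoint T S := forall x y : H, inner (T x) y = inner x (S y).

(* The default \0 is irrelevant for bounded T: by the Riesz representation
   theorem such a T has an adjoint, which is unique. *)
Definition adjoint T : {linear H -> H} :=
  xget (\0 : {linear H -> H}) [set S | is_adjoint T S].

Definition re_op T : {linear H -> H} := 2^-1 \*: (T \+ adjoint T).

Definition im_op T : {linear H -> H} := (2 * 'i%C)^-1 \*: (T \- adjoint T).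

End Operators.

(* Main.v *)
Require Import Defs.
From HB Require Import structures.
From mathcomp Require Import all_boot all_order all_algebra.
From mathcomp Require Import all_classical all_reals all_analysis.
From mathcomp Require Import sesquilinear complex ring lra.

(** Write A = Re(T), B = Im(T). Expanding squares,
      4 |A x|^2 = |T x + T^* x|^2 and 4 |B x|^2 = |T x - T^* x|^2,
    and in both the cross term is +/- 2 Re <T x, T^* x> = +/- 2 Re <T^2 x, x>,
    which for a unit vector x is at most 2 w(T^2) in absolute value. Hence
    |T x|^2 + |T^* x|^2 is at most 4 |A|^2 + 2 w(T^2), and likewise with B
    ([sqr_rnorm_re_op], [sqr_rnorm_im_op], [normr_rinner_adjoint_le]).

    On the other hand <T x, x>^2 = <a, x><x, b> with a = T x and b = T^* x,
    and for such a product [Buzano_inequality] improves on Cauchy-Schwarz: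
    |<a, x><x, b>| <= (|a| |b| + |<a, b>|) / 2. Here the last term is
    |<T^2 x, x>| <= w(T^2), and |a| |b| is at most (|T x|^2 + |T^* x|^2) / 2;
    this gives |<T x, x>|^2 <= w(T^2) + |A|^2, and the same with B
    ([sqr_rnorm_inner_le]).

    All of this needs a genuine adjoint, whereas [adjoint] is a choice with a
    default value. So the existence of the adjoint of a bounded operator
    ([bounded_adjoint_exists]) is derived from the Riesz representation theorem
    ([Riesz_representation]), which is the only place where completeness of the
    space is used. *)

Set Implicit Arguments.
Unset Strict Implicit.
Unset Printing Implicit Defensive.

Import Order.TTheory GRing.Theory Num.Theory.
Import numFieldNormedType.Exports.

Local Open Scope classical_set_scope.
Local Open Scope ring_scope.

(** * Real-valued norms and complex numbers *)

Section RealNorm.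
Context {R : realType}.

Section NormedZmod.
Context {V : normedZmodType R[i]}.
Implicit Types x y : V.

Lemma rnormE x : `|x| = (rnorm x)%:C%C.
Proof. by rewrite /rnorm RRe_real// normr_real. Qed.

Lemma rnorm_ge0 x : 0 <= rnorm x.
Proof. by rewrite -ler0c -rnormE. Qed.

Lemma rnormN x : rnorm (- x) = rnorm x.
Proof. by rewrite /rnorm normrN. Qed.

Lemma rnorm_eq0 x : rnorm x = 0 -> x = 0.
Proof. by move=> x0; apply/normr0_eq0; rewrite rnormE x0. Qed.

Lemma ler_rnormD x y : rnorm (x + y) <= rnorm x + rnorm y.
Proof. by rewrite -lecR rmorphD /= -!rnormE ler_normD. Qed.

End NormedZmod.

Lemma rnormZ {V : normedModType R[i]} (c : R[i]) (x : V) :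
  rnorm (c *: x) = rnorm c * rnorm x.
Proof. by apply: complexI; rewrite rmorphM /= -!rnormE normrZ. Qed.

Implicit Types c d : R[i].

Lemma rnormM c d : rnorm (c * d) = rnorm c * rnorm d.
Proof. by apply: complexI; rewrite rmorphM /= -!rnormE normrM. Qed.

Lemma rnorm_conj c : rnorm (Num.conj c) = rnorm c.
Proof. by rewrite /rnorm norm_conjC. Qed.

Lemma rnorm_real (t : R) : rnorm t%:C%C = `|t|.
Proof. by rewrite /rnorm normc_def /= expr0n /= addr0 sqrtr_sqr. Qed.

Lemma normr_Re_le c : `|complex.Re c| <= rnorm c.
Proof. by rewrite -lecR -rnormE normc_ge_Re. Qed.

Lemma ReD c d : complex.Re (c + d) = complex.Re c + complex.Re d.
Proof. by case: c d => [? ?] [? ?]. Qed.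

Lemma ReN c : complex.Re (- c) = - complex.Re c.
Proof. by case: c. Qed.

Lemma ReZ (t : R) c : complex.Re (t%:C%C * c) = t * complex.Re c.
Proof. by case: c => [a b] /=; rewrite mul0r subr0. Qed.

Lemma conj_mul_rnorm c : Num.conj c * c = (rnorm c ^+ 2)%:C%C.
Proof. by rewrite rmorphXn /= -rnormE normCK mulrC. Qed.

End RealNorm.

(** * Inner product, Cauchy-Schwarz and Buzano *)

Section InnerProduct.
Context {R : realType} {H : hilbertType R}.
Implicit Types (x y z : H) (c : R[i]).

Lemma innerC x y : inner x y = Num.conj (inner y x).
Proof. by rewrite (hermC inner) expr0 mul1r. Qed.

Lemma innerDl x y z : inner (x + y) z = inner x z + inner y z.
Proof. exact: linearDl. Qed.

Lemma innerBl x y z : inner (x - y) z = inner x z - inner y z.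
Proof. exact: linearBl. Qed.

Lemma innerDr x y z : inner x (y + z) = inner x y + inner x z.
Proof. exact: linearDr. Qed.

Lemma innerBr x y z : inner x (y - z) = inner x y - inner x z.
Proof. exact: linearBr. Qed.

Lemma innerZl c x y : inner (c *: x) y = c * inner x y.
Proof. exact: linearZl_LR. Qed.

Lemma innerZr c x y : inner x (c *: y) = Num.conj c * inner x y.
Proof. exact: linearZr_LR. Qed.

(** The Hilbert space seen as a real inner product space: squared norms expand
    bilinearly in it, with values in the ordered field [R]. *)
Definition rinner x y : R := complex.Re (inner x y).

Lemma rinnerC x y : rinner x y = rinner y x.
Proof.
by rewrite /rinner innerC; apply: complexI; rewrite !complexRe Re_conj.
Qed.

Lemma rinnerDl x y z : rinner (x + y) z = rinner x z + rinner y z.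
Proof. by rewrite /rinner innerDl ReD. Qed.

Lemma rinnerDr x y z : rinner x (y + z) = rinner x y + rinner x z.
Proof. by rewrite !(rinnerC x) rinnerDl. Qed.

Lemma rinnerZl (t : R) x y : rinner (t%:C%C *: x) y = t * rinner x y.
Proof. by rewrite /rinner innerZl ReZ. Qed.

Lemma rinnerZr (t : R) x y : rinner x (t%:C%C *: y) = t * rinner x y.
Proof. by rewrite !(rinnerC x) rinnerZl. Qed.

Lemma rinnerNl x y : rinner (- x) y = - rinner x y.
Proof. by rewrite /rinner linearNl ReN. Qed.

Lemma rinnerNr x y : rinner x (- y) = - rinner x y.
Proof. by rewrite !(rinnerC x) rinnerNl. Qed.

Lemma rinnerxx x : rinner x x = rnorm x ^+ 2.
Proof. by rewrite /rinner -sqr_norm_inner rnormE -rmorphXn. Qed.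

Lemma inner_eq0 x : inner x x = 0 -> x = 0.
Proof.
by move=> x0; apply/rnorm_eq0/eqP; rewrite -sqrf_eq0 -rinnerxx /rinner x0.
Qed.

Lemma sqr_rnormD x y :
  rnorm (x + y) ^+ 2 = rnorm x ^+ 2 + 2 * rinner x y + rnorm y ^+ 2.
Proof.
by rewrite -!rinnerxx rinnerDl !rinnerDr (rinnerC y x); ring.
Qed.

Lemma sqr_rnormB x y :
  rnorm (x - y) ^+ 2 = rnorm x ^+ 2 - 2 * rinner x y + rnorm y ^+ 2.
Proof. by rewrite sqr_rnormD rinnerNr rnormN mulrN. Qed.

(** The nonnegative quantity is the squared norm of |y| x - |x| y. *)
Lemma rinner_le x y : rinner x y <= rnorm x * rnorm y.
Proof.
have [/rnorm_eq0->|y0] := eqVneq (rnorm y) 0.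
  by rewrite -(scale0r y) rinnerZr mul0r mulr_ge0// rnorm_ge0.
have y_gt0 : 0 < rnorm y by rewrite lt_def y0 rnorm_ge0.
have := sqr_ge0 (rnorm ((rnorm y)%:C%C *: x - (rnorm x)%:C%C *: y)).
rewrite sqr_rnormB rinnerZl rinnerZr !rnormZ !rnorm_real.
rewrite !ger0_norm ?rnorm_ge0//.
have [/rnorm_eq0-> _|x0] := eqVneq (rnorm x) 0.
  by rewrite -(scale0r x) rinnerZl mul0r mulr_ge0// rnorm_ge0.
have x_gt0 : 0 < rnorm x by rewrite lt_def x0 rnorm_ge0.
move=> h; rewrite -(ler_pM2l (mulr_gt0 x_gt0 y_gt0)).
nra.
Qed.

(** The complex inequality reduces to the real one for c^* x and y, where
    c = <x, y>: their inner product is |c|^2. *)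
Lemma CauchySchwarz_rnorm x y : rnorm (inner x y) <= rnorm x * rnorm y.
Proof.
set c := inner x y; have [->|c0] := eqVneq (rnorm c) 0.
  by rewrite mulr_ge0// rnorm_ge0.
have c_gt0 : 0 < rnorm c by rewrite lt_def c0 rnorm_ge0.
rewrite -(ler_pM2l c_gt0) mulrA -(rnorm_conj c) -(rnormZ _ x).
apply: le_trans (rinner_le _ _).
by rewrite /rinner innerZl -/c conj_mul_rnorm /= rnorm_conj expr2.
Qed.

Lemma normr_rinner_le x y : `|rinner x y| <= rnorm x * rnorm y.
Proof. exact: le_trans (normr_Re_le _) (CauchySchwarz_rnorm x y). Qed.

(** The reflection a |-> u = 2 <a, x> x - a through the line of the unit vector
    x is isometric, and <u, b> + <a, b> = 2 <a, x><x, b>; Cauchy-Schwarz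
    bounds <u, b>. *)
Lemma Buzano_inequality a b x : rnorm x = 1 ->
  2 * rnorm (inner a x * inner x b) <=
  rnorm a * rnorm b + rnorm (inner a b).
Proof.
move=> x1; pose u := (2 * inner a x) *: x - a.
have rn2 : rnorm (2 : R[i]) = 2.
  by rewrite -(rmorph_nat (real_complex R)) rnorm_real ger0_norm.
have ua : rnorm u = rnorm a.
  apply/eqP; rewrite -(@eqrXn2 _ 2) ?rnorm_ge0//; apply/eqP.
  rewrite sqr_rnormB rnormZ rnormM rn2 x1 /rinner innerZl (innerC x a).
  rewrite -(mulrA _ (inner a x)).
  rewrite (mulrC (inner a x)) conj_mul_rnorm.
  rewrite -(rmorph_nat (real_complex R)) ReZ /=.
  ring.
have -> : 2 * rnorm (inner a x * inner x b) = rnorm (inner u b + inner a b).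
  by rewrite innerBl subrK innerZl -mulrA -[X in X * _]rn2 -rnormM.
by rewrite (le_trans (ler_rnormD _ _))// lerD2r -ua CauchySchwarz_rnorm.
Qed.

End InnerProduct.

(** * Riesz representation *)

Section Riesz.
Context {R : realType} {H : hilbertType R}.
Implicit Types (x y z : H) (c : R[i]).

Lemma natSinv_lt (e : R) : 0 < e -> exists N, N.+1%:R^-1 < e.
Proof.
move=> e0; exists (Num.truncn e^-1).
by rewrite -ltf_pV2 ?(posrE, invr_gt0)// invrK truncnS_gt.
Qed.

(** Cauchy sequences for the [R]-valued norm converge; the uniform structure of
    the space has its radii in [R[i]]. *)
Lemma rnorm_complete (u : nat -> H) :
  (forall e : R, 0 < e ->
    exists N, forall n, (N <= n)%N -> rnorm (u N - u n) < e) ->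
  exists y, forall e : R, 0 < e ->
    exists N, forall n, (N <= n)%N -> rnorm (y - u n) < e.
Proof.
move=> cu.
have : cvg (u @ \oo).
  apply: cauchy_cvg; apply: cauchy_exP => e e0.
  have eE : (complex.Re e)%:C%C = e by rewrite RRe_real// gtr0_real.
  have [|N uN] := cu (complex.Re e); first by rewrite -(ltcR 0) eE.
  exists (u N); exists N => // n /= Nn.
  by rewrite -ball_normE /= rnormE -eE ltcR uN.
move=> /cvgrPdist_lt uy; exists (lim (u @ \oo)) => e e0.
have [|N _ uN] := uy e%:C%C; first by rewrite (ltcR 0).
by exists N => n Nn; have := uN n Nn; rewrite /= rnormE ltcR.
Qed.

(** The representing vector is the minimizer of J x = |x|^2 - 2 Re (f x): the
    parallelogram law makes minimizing sequences Cauchy, and the first variation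
    of J in a direction x is Re <z, x> - Re (f x). Instead of showing that J
    attains its minimum at the limit, the first variation is bounded along the
    minimizing sequence and then passed to the limit. *)
Lemma Riesz_representation (f : H -> R[i]) (K : R) :
  scalar f -> (forall x, rnorm (f x) <= K * rnorm x) ->
  exists z, forall x, f x = inner x z.
Proof.
move=> fL fK.
have fD x y : f (x + y) = f x + f y by rewrite -{1}(scale1r x) fL mul1r.
have f0 : f 0 = 0 by apply: (addrI (f 0)); rewrite -fD !addr0.
have fZ c x : f (c *: x) = c * f x by rewrite -(addr0 (_ *: _)) fL f0 addr0.
pose g x := complex.Re (f x).
have gD x y : g (x + y) = g x + g y by rewrite /g fD ReD.
have gZ (t : R) x : g (t%:C%C *: x) = t * g x by rewrite /g fZ ReZ.
have gK x : g x <= K * rnorm x.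
  exact: le_trans (le_trans (ler_norm _) (normr_Re_le _)) (fK x).
pose J x := rnorm x ^+ 2 - 2 * g x.
have J_ge x : - K ^+ 2 <= J x.
  rewrite /J; have := gK x; have := sqr_ge0 (rnorm x - K); nra.
pose d := inf (range J).
have hinf : has_inf (range J).
  by split; [exists (J 0), 0 | exists (- K ^+ 2) => _ [x _ <-]].
have dJ x : d <= J x by apply: ge_inf; [exact: hinf.2 | exists x].
have /choice[u uJ] : forall n : nat, exists x, J x < d + n.+1%:R^-1.
  move=> n; have n0 : 0 < n.+1%:R^-1 :> R by rewrite invr_gt0 ltr0n.
  by have [_ [x _ <-]] := inf_adherent n0 hinf; exists x.
have parallelogram x y :
    rnorm (x - y) ^+ 2 = 2 * J x + 2 * J y - 4 * J ((2^-1 : R)%:C%C *: (x + y)).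
  rewrite /J gZ gD rnormZ rnorm_real ger0_norm ?invr_ge0// exprMn.
  rewrite sqr_rnormB sqr_rnormD.
  by field.
have cu (e : R) : 0 < e ->
    exists N, forall n, (N <= n)%N -> rnorm (u N - u n) < e.
  move=> e0; have [|N Ne] := @natSinv_lt (e ^+ 2 / 4).
    by rewrite divr_gt0// exprn_gt0.
  exists N => n Nn.
  rewrite -(@ltr_pXn2r _ 2) ?nnegrE ?rnorm_ge0 ?(ltW e0)// parallelogram.
  have := dJ ((2^-1 : R)%:C%C *: (u N + u n)).
  have := uJ N; have := uJ n.
  have : n.+1%:R^-1 <= N.+1%:R^-1 :> R by rewrite lef_pV2 ?posrE// ler_nat.
  move: Ne; rewrite ltr_pdivlMr//.
  move: (J _) (J _) (J _) (N.+1%:R^-1) (n.+1%:R^-1) (d) (e ^+ 2).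
  by move=> *; lra.
have [y uy] := rnorm_complete cu.
have variation n x : (rinner (u n) x - g x) ^+ 2 <= rnorm x ^+ 2 * n.+1%:R^-1.
  (* With a = Re <u n, x> - Re (f x), the step t = - a / |x|^2 minimizes
     J (u n + t x) = J (u n) + 2 t a + t^2 |x|^2, the drop being a^2 / |x|^2. *)
  have [/rnorm_eq0->|x0] := eqVneq (rnorm x) 0.
    rewrite -(scale0r x) rinnerZr gZ !mul0r subrr expr0n.
    by rewrite mulr_ge0 ?sqr_ge0// invr_ge0.
  have x_gt0 : 0 < rnorm x ^+ 2 by rewrite exprn_even_gt0.
  set a := rinner _ _ - _.
  have ra : rinner (u n) x = a + g x by rewrite subrK.
  clearbody a; pose t := - a / rnorm x ^+ 2.
  have := dJ (u n + t%:C%C *: x); have := uJ n.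
  rewrite /J sqr_rnormD gD gZ rnormZ rnorm_real rinnerZr exprMn.
  rewrite real_normK ?num_real//.
  have tx : t * rnorm x ^+ 2 = - a by rewrite /t divfK ?gt_eqF.
  have -> : t ^+ 2 * rnorm x ^+ 2 = - a * t by rewrite expr2 -mulrA tx mulrC.
  move=> Jun Jv; have h : 0 < n.+1%:R^-1 + a * t.
    move: Jun Jv; rewrite ra; move: (n.+1%:R^-1) (d) (t) => i d' t'; lra.
  have := mulr_gt0 h x_gt0; rewrite mulrDl -mulrA tx.
  by rewrite mulrN -expr2 subr_gt0 mulrC => /ltW.
have gy x : g x = rinner y x.
  (* Every e > 0 yields D^2 <= 4 |x|^2 e^2 for the defect D, so the choice
     e = |D| / (4 |x| + 1) is contradictory unless D = 0. *)
  apply/eqP; rewrite eq_sym -subr_eq0; apply/negPn/negP => D0.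
  set D := _ - _ in D0; pose r := rnorm x; pose e : R := `|D| / (4 * r + 1).
  have r0 : 0 <= r by rewrite rnorm_ge0.
  have r1 : 0 < 4 * r + 1 by lra.
  have e0 : 0 < e by rewrite divr_gt0// normr_gt0.
  have De : D ^+ 2 = e ^+ 2 * (4 * r + 1) ^+ 2.
    by rewrite -exprMn divfK ?gt_eqF// real_normK ?num_real.
  have [N uN] := uy _ e0; have [M Me] := natSinv_lt (exprn_gt0 2 e0).
  set n := maxn N M; have {uN} := uN n (leq_maxl _ _).
  have : n.+1%:R^-1 <= M.+1%:R^-1 :> R.
    by rewrite lef_pV2 ?posrE// ler_nat ltnS leq_maxr.
  move=> /le_lt_trans/(_ Me) ne ue.
  set a := rinner (u n) x - g x; set b := rinner (y - u n) x.
  have ae : a ^+ 2 <= r ^+ 2 * e ^+ 2.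
    by rewrite (le_trans (variation n x))// ler_wpM2l ?sqr_ge0// ltW.
  have be : b ^+ 2 <= r ^+ 2 * e ^+ 2.
    rewrite -exprMn -(real_normK (num_real b)).
    rewrite ler_pXn2r ?nnegrE ?(mulr_ge0 r0 (ltW e0))//.
    by rewrite /b (le_trans (normr_rinner_le _ _))// mulrC ler_wpM2l// ltW.
  have Dab : D = a + b by rewrite /D /a /b rinnerDl rinnerNl; ring.
  have : D ^+ 2 <= 2 * a ^+ 2 + 2 * b ^+ 2.
    by rewrite Dab; have := sqr_ge0 (a - b); lra.
  rewrite De; have e2 : 0 < e ^+ 2 by rewrite exprn_gt0.
  have : 0 <= e ^+ 2 * r by rewrite mulr_ge0// ltW.
  have : 0 <= e ^+ 2 * r ^+ 2 by rewrite mulr_ge0 ?sqr_ge0// ltW.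
  by move: ae be e2; move: (a ^+ 2) (b ^+ 2) (e ^+ 2) => A B E; lra.
exists y => x; apply/eqP; rewrite eq_complex.
(* Imaginary parts are recovered from the real part at i x. *)
have := gy x; have := gy ('i%C *: x).
rewrite /g fZ !(rinnerC y) /rinner innerZl !(mulrC 'i%C) !ReiNIm.
by move=> /oppr_inj-> ->; rewrite !eqxx.
Qed.

End Riesz.

(** * Adjoints, operator norm and numerical radius *)

(** This covers unbounded and empty sets, whose supremum is 0 by convention. *)
Lemma sup_ge0 (R : realType) (E : set R) :
  (forall t, E t -> 0 <= t) -> 0 <= sup E.
Proof.
move=> E0; have [[[t Et] ubE]|/sup_out->//] := pselect (has_sup E).
exact: le_trans (E0 t Et) (ub_le_sup ubE Et).
Qed.

Section Operators.
Context {R : realType} {H : hilbertType R}.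
Implicit Types (T S : {linear H -> H}) (x y z : H).

Lemma inner_injr y z : (forall x, inner x y = inner x z) -> y = z.
Proof.
move=> yz; apply/eqP; rewrite -subr_eq0; apply/eqP/inner_eq0.
by rewrite innerBr yz subrr.
Qed.

Lemma bounded_op_ge0 T : bounded_op T ->
  exists2 M : R, 0 <= M & forall x, rnorm (T x) <= M * rnorm x.
Proof.
move=> [M TM]; exists `|M| => // x.
by rewrite (le_trans (TM x))// ler_wpM2r ?rnorm_ge0// ler_norm.
Qed.

Lemma bounded_adjoint_exists T : bounded_op T ->
  exists S : {linear H -> H}, is_adjoint T S.
Proof.
move=> /bounded_op_ge0[M M0 TM].
have /choice[S TS] y : exists z, forall x, inner (T x) y = inner x z.
  apply: (@Riesz_representation _ _ _ (M * rnorm y)) => [c u v|x].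
    by rewrite linearP innerDl innerZl.
  rewrite (le_trans (CauchySchwarz_rnorm _ _))// mulrAC.
  by rewrite ler_wpM2r ?rnorm_ge0.
have S_linear : linear S.
  move=> c u v; apply: inner_injr => x.
  by rewrite -TS !innerDr !innerZr !TS.
pose m := GRing.isLinear.Build _ _ _ _ S S_linear.
pose SL : {linear H -> H} := HB.pack S m.
by exists SL => x y; exact: TS.
Qed.

Lemma adjointP T : bounded_op T -> is_adjoint T (adjoint T).
Proof.
move=> /bounded_adjoint_exists[S TS].
exact: (xgetI (\0 : {linear H -> H}) TS).
Qed.

(** Since |S y|^2 = <T (S y), y> <= M |S y| |y|. *)
Lemma bounded_adjoint T S : is_adjoint T S -> bounded_op T -> bounded_op S.
Proof.
move=> TS /bounded_op_ge0[M M0 TM]; exists M => y.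
have [->|Sy0] := eqVneq (rnorm (S y)) 0; first by rewrite mulr_ge0 ?rnorm_ge0.
have Sy_gt0 : 0 < rnorm (S y) by rewrite lt_def Sy0 rnorm_ge0.
rewrite -(ler_pM2l Sy_gt0) -expr2 -rinnerxx /rinner -TS.
rewrite (le_trans (ler_norm _))// (le_trans (normr_rinner_le _ _))//.
by rewrite mulrA (mulrC _ M) ler_wpM2r ?rnorm_ge0.
Qed.

Lemma rnorm_le_opnorm T x : bounded_op T -> rnorm x <= 1 ->
  rnorm (T x) <= opnorm T.
Proof.
move=> /bounded_op_ge0[M M0 TM] x1; apply: ub_le_sup; last by exists x.
exists M => _ [y /= y1 <-].
by rewrite (le_trans (TM y))// ler_piMr.
Qed.

Lemma rnorm_inner_le_numrad T x : bounded_op T -> rnorm x = 1 ->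
  rnorm (inner (T x) x) <= numrad T.
Proof.
move=> /bounded_op_ge0[M M0 TM] x1; apply: ub_le_sup; last by exists x.
exists M => _ [y /= y1 <-].
rewrite (le_trans (CauchySchwarz_rnorm _ _))// y1 mulr1.
by rewrite (le_trans (TM y))// y1 mulr1.
Qed.

Lemma opnorm_ge0 T : 0 <= opnorm T.
Proof. by apply: sup_ge0 => _ [x _ <-]; exact: rnorm_ge0. Qed.

Lemma sqr_rnorm_le_opnorm T x : bounded_op T -> rnorm x = 1 ->
  rnorm (T x) ^+ 2 <= opnorm T ^+ 2.
Proof.
move=> bT x1; rewrite ler_pXn2r ?nnegrE ?rnorm_ge0 ?opnorm_ge0//.
by apply: rnorm_le_opnorm; rewrite ?x1.
Qed.

Lemma numrad_ge0 T : 0 <= numrad T.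
Proof. by apply: sup_ge0 => _ [x _ <-]; exact: rnorm_ge0. Qed.

(** The square root bounds the set whose supremum is [numrad]; when there is no
    unit vector that supremum is 0 and [0 <= K] is what makes the bound hold. *)
Lemma sqr_numrad_le T (K : R) : 0 <= K ->
  (forall x, rnorm x = 1 -> rnorm (inner (T x) x) ^+ 2 <= K) ->
  numrad T ^+ 2 <= K.
Proof.
move=> K0 TK; rewrite -(sqr_sqrtr K0).
rewrite ler_pXn2r ?nnegrE ?numrad_ge0 ?sqrtr_ge0//.
have ubK : ubound [set rnorm (inner (T x) x) | x in [set x : H | rnorm x = 1]]
    (Num.sqrt K).
  move=> _ [x /= x1 <-]; rewrite -(ler_pXn2r (n := 2)) ?nnegrE ?rnorm_ge0//.
  by rewrite sqr_sqrtr// TK.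
rewrite /numrad.
have [->|/set0P ne] := eqVneq
  [set rnorm (inner (T x) x) | x in [set x : H | rnorm x = 1]] set0.
  by rewrite sup0 sqrtr_ge0.
exact: ge_sup.
Qed.

Lemma bounded_comp T S : bounded_op T -> bounded_op S -> bounded_op (T \o S).
Proof.
move=> /bounded_op_ge0[M M0 TM] [N SN]; exists (M * N) => x /=.
by rewrite (le_trans (TM _))// -mulrA ler_wpM2l.
Qed.

Lemma bounded_re_op T : bounded_op T -> bounded_op (re_op T).
Proof.
move=> bT; have [N SN] := bounded_adjoint (adjointP bT) bT.
have [M TM] := bT; exists (rnorm (2^-1 : R[i]) * (M + N)) => x.
rewrite rnormZ -mulrA ler_wpM2l ?rnorm_ge0// mulrDl.
by rewrite (le_trans (ler_rnormD _ _))// lerD.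
Qed.

Lemma bounded_im_op T : bounded_op T -> bounded_op (im_op T).
Proof.
move=> bT; have [N SN] := bounded_adjoint (adjointP bT) bT.
have [M TM] := bT; exists (rnorm ((2 * 'i%C)^-1 : R[i]) * (M + N)) => x.
rewrite rnormZ -mulrA ler_wpM2l ?rnorm_ge0// mulrDl.
by rewrite (le_trans (ler_rnormD _ _))// rnormN lerD.
Qed.

Lemma sqr_rnorm_re_op T x :
  4 * rnorm (re_op T x) ^+ 2 = rnorm (T x + adjoint T x) ^+ 2.
Proof.
have -> : re_op T x = (2^-1 : R)%:C%C *: (T x + adjoint T x).
  by rewrite fmorphV rmorph_nat.
rewrite rnormZ rnorm_real ger0_norm ?invr_ge0// exprMn mulrA.
by rewrite -[RHS]mul1r; congr (_ * _); field.
Qed.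

Lemma sqr_rnorm_im_op T x :
  4 * rnorm (im_op T x) ^+ 2 = rnorm (T x - adjoint T x) ^+ 2.
Proof.
have -> : im_op T x = (2 * 'i%C)^-1 *: (T x - adjoint T x) by [].
have half : rnorm ((2 * 'i%C)^-1 : R[i]) = 2^-1.
  apply: complexI; rewrite -rnormE normfV normrM complexiE normCi mulr1.
  by rewrite fmorphV normr_nat rmorph_nat.
rewrite rnormZ half exprMn mulrA.
by rewrite -[RHS]mul1r; congr (_ * _); field.
Qed.

(** Buzano's inequality at a = T x, b = T^* x, where <a, b> = <T^2 x, x>,
    followed by 2 |a| |b| <= |a|^2 + |b|^2. *)
Lemma sqr_rnorm_inner_le T x (K : R) : bounded_op T -> rnorm x = 1 ->
  rnorm (T x) ^+ 2 + rnorm (adjoint T x) ^+ 2 <= 4 * K + 2 * numrad (T \o T) ->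
  rnorm (inner (T x) x) ^+ 2 <= numrad (T \o T) + K.
Proof.
move=> bT x1 TK; have TS := adjointP bT.
have w2 := rnorm_inner_le_numrad (bounded_comp bT bT) x1.
have := Buzano_inequality (T x) (adjoint T x) x1.
rewrite -!TS rnormM -expr2.
have := sqr_ge0 (rnorm (T x) - rnorm (adjoint T x)).
move: w2 TK => /=; move: (rnorm _) (rnorm _) (rnorm _) (rnorm _) (numrad _).
by move=> *; nra.
Qed.

(** The cross term in the expansion of |T x +/- T^* x|^2. *)
Lemma normr_rinner_adjoint_le T x : bounded_op T -> rnorm x = 1 ->
  `|rinner (T x) (adjoint T x)| <= numrad (T \o T).
Proof.
move=> bT x1; rewrite (le_trans (normr_Re_le _))// -adjointP//.
exact: rnorm_inner_le_numrad (bounded_comp bT bT) x1.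
Qed.

End Operators.

(** * The numerical radius inequality *)

Theorem theorem2p2 (R : realType) (H : hilbertType R) (T : {linear H -> H})
    (hT : bounded_op T) :
  numrad T ^+ 2 <=
    numrad (T \o T) + Num.min (opnorm (re_op T) ^+ 2) (opnorm (im_op T) ^+ 2).
Proof.
apply: sqr_numrad_le => [|x x1].
  by rewrite addr_ge0 ?numrad_ge0// le_min !sqr_ge0.
have := normr_rinner_adjoint_le hT x1; rewrite ler_norml => /andP[geN le].
rewrite addr_minr le_min; apply/andP; split; apply: sqr_rnorm_inner_le => //.
- have := sqr_rnorm_le_opnorm (bounded_re_op hT) x1.
  have := sqr_rnorm_re_op T x; rewrite sqr_rnormD.
  lra.
- have := sqr_rnorm_le_opnorm (bounded_im_op hT) x1.
  have := sqr_rnorm_im_op T x; rewrite sqr_rnormB.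
  lra.
Qed.
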